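(* Let $N\ge2$ and let $\Gamma_1,\dots,\Gamma_N\in\mathbb Q$ be positive rational numbers. Let $\mathcal H_1\subset\mathbb R$ be the set of energies $H(\mathbf z)$ of normalised relative equilibria $\mathbf z$ of the planar $N$-vortex problem with vorticities $\Gamma_1,\dots,\Gamma_N$. Then $\mathcal H_1$ is a finite set.
   Context: The planar $N$-vortex problem with vorticities $\Gamma_1,\dots,\Gamma_N$ is the system $\mathbf\Gamma\,\dot{\mathbf z}(t)=\mathcal J_N\nabla H(\mathbf z(t))$, for $\mathbf z=(z_1,\dots,z_N)$, $z_i=(x_i,y_i)\in\mathbb R^2$, on $\mathbb R^{2N}\setminus\Delta$, where $\Delta=\{\mathbf z: z_i=z_j\text{ for some }i<j\}$, $H(\mathbf z)=-\frac1{4\pi}\sum_{1\le i<j\le N}\Gamma_i\Gamma_j\log|z_i-z_j|^2$, $\mathbf\Gamma=\mathrm{diag}(\Gamma_1,\Gamma_1,\dots,\Gamma_N,\Gamma_N)$, and $\mathcal J_N$ is block diagonal with $N$ blocks $\mathbb J=\begin{bmatrix}0&1\\-1&0\end{bmatrix}$. $H$ is constant along each orbit (solution). An orbit is normalised if along it $\sum_i\Gamma_iz_i=0$ and $I(\mathbf z)=\sum_i\Gamma_i|z_i|^2=1$. A relative equilibrium is a solution of the form $z_i(t)=e^{\mathbb J\omega t}(z_i(0)-c)+c$ for all $i$, with $\omega\in\mathbb R$ and $c=\sum_i\Gamma_iz_i/\sum_i\Gamma_i$. *)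

(* Defs.v *)
(* MathComp-Analysis; [R : realType] is the field of real numbers. *)
From HB Require Import structures.
From mathcomp Require Export all_boot all_order all_algebra.
From mathcomp Require Export all_classical all_reals all_analysis.
Set Implicit Arguments.
Unset Strict Implicit.
Unset Printing Implicit Defensive.
Export Order.TTheory GRing.Theory Num.Theory.
Export numFieldNormedType.Exports.
#[export] Set Warnings "-notation-overridden".
Local Open Scope classical_set_scope.
Local Open Scope ring_scope.

Section NVortex.
Context {R : realType} {N : nat}.

(* A configuration z = (z_1, ..., z_N) is a 2 x N matrix whose i-th column is
   z_i = (x_i, y_i); the vorticities form a row vector.  With this layout the
   diagonal matrix diag(Gamma_1, Gamma_1, ..., Gamma_N, Gamma_N) acts on
   R^(2N) as right multiplication by [diag_mx Gamma], and the block diagonal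
   matrix with N blocks J acts as left multiplication by J. *)
Implicit Types (Gamma : 'rV[R]_N) (z : 'M[R]_(2, N)).

Definition Jmx : 'M[R]_2 :=
  \matrix_(i, j) if i == j then 0 else if i == 0 then 1 else -1.

Definition expmx (A : 'M[R]_2) : 'M[R]_2 :=
  limn (series (fun k => (k`!%:R)^-1 *: A ^+ k)).

(* |u|^2 for the Euclidean norm; the library norm on matrices is the sup
   norm. *)
Definition sqnorm (u : 'cV[R]_2) : R := \sum_k u k 0 ^+ 2.

Definition collision : set 'M[R]_(2, N) :=
  [set z | exists i j : 'I_N, (i < j)%N /\ col i z = col j z].

Definition hamiltonian Gamma z : R :=
  - (4 * pi)^-1 *
    \sum_(i < N) \sum_(j < N | (i < j)%N)
      Gamma 0 i * Gamma 0 j * ln (sqnorm (col i z - col j z)).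

Definition gradient (f : 'M[R]_(2, N) -> R) z : 'M[R]_(2, N) :=
  \matrix_(k, i) 'D_(delta_mx k i) f z.

Definition vortex_solution Gamma (z : R -> 'M[R]_(2, N)) : Prop :=
  forall t : R,
    [/\ ~ collision (z t), derivable z t 1
      & 'D_1 z t *m diag_mx Gamma = Jmx *m gradient (hamiltonian Gamma) (z t)].

Definition moment Gamma z : 'cV[R]_2 := \sum_i Gamma 0 i *: col i z.

Definition vortex_center Gamma z : 'cV[R]_2 :=
  (\sum_i Gamma 0 i)^-1 *: moment Gamma z.

Definition inertia Gamma z : R := \sum_i Gamma 0 i * sqnorm (col i z).

Definition normalised Gamma (z : R -> 'M[R]_(2, N)) : Prop :=
  forall t : R, moment Gamma (z t) = 0 /\ inertia Gamma (z t) = 1.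

(* The centre of vorticity is a first integral, so it is read at time 0. *)
Definition relative_equilibrium Gamma (z : R -> 'M[R]_(2, N)) : Prop :=
  vortex_solution Gamma z /\
  exists omega : R, forall (t : R) (i : 'I_N),
    let c := vortex_center Gamma (z 0) in
    col i (z t) = expmx ((omega * t) *: Jmx) *m (col i (z 0) - c) + c.

(* The Hamiltonian is constant along solutions, so the energy of an orbit is
   its value at time 0. *)
Definition relative_equilibrium_energies Gamma : set R :=
  [set h | exists z : R -> 'M[R]_(2, N),
     [/\ relative_equilibrium Gamma z, normalised Gamma z
       & h = hamiltonian Gamma (z 0)]].

End NVortex.

(* Main.v *)
Require Import Defs.
From HB Require Import structures.
From mathcomp Require Import ring.
Set Implicit Arguments.
Unset Strict Implicit.
Unset Printing Implicit Defensive.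
Local Open Scope classical_set_scope.
Local Open Scope ring_scope.

(** A normalised relative equilibrium rotates rigidly about the origin, so its
    position z at time 0 satisfies grad H (z) = omega Gamma z: it is a critical
    point of H restricted to the sphere I = 1.  The theorem says that such a
    constrained critical point problem has finitely many critical values, and
    this holds because rational vorticities make the problem algebraic.  If d
    clears the denominators, d Gamma_i = g_i with g_i a natural number, then
    exp (- 4 pi d^2 H) is the polynomial
      v (z) = prod_(a < b) (|z_a - z_b|^2) ^ (g_a g_b),
    an injective function of the energy, and the critical point equations are
    polynomial in z, omega and the inverse squared distances.

    The finiteness is an algebraic form of Sard's theorem.  Suppose that there
    are infinitely many energies and choose critical points z_n with pairwise
    distinct values v_n.  In an ultrapower L of the reals the class of (z_n) is
    again a critical point z, now with coordinates in L, and its critical value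
    v is transcendental over the integers, since a nonzero polynomial kills
    only finitely many of the v_n ([exists_ultrapower]).  In characteristic 0 a
    transcendental element can be moved infinitesimally, and every other
    element follows: there is a derivation with D v = 1 on a ring containing v
    and the coordinates of z.  Along that derivation
      D v / v =
        2 sum_(a < b) g_a g_b (z_a - z_b).(D z_a - D z_b) / |z_a - z_b|^2,
    which the critical point equations turn into a multiple of D I.  As I is
    constant along the z_n, D I = 0, hence D v = 0, against D v = 1
    ([critical_value_algebraic]).

    The derivation is handled as a morphism a |-> a + eps D a into the dual
    numbers L[eps].  It is built by adjoining one element at a time
    ([adjoin_no_vertical]), starting from the integers. *)

(** * Ultrapowers of a field *)

Section Ultrapower.
Local Open Scope quotient_scope.
Context {R : fieldType} {U : set_system nat} {UU : UltraFilter U}.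

(** The ideal of the sequences that vanish on a member of the ultrafilter [U];
    it is maximal, and the ultrapower is the quotient by it. *)
Definition null_seq : {pred nat -> R} :=
  fun a : nat -> R => `[< U [set n | a n = 0] >].

Lemma null_seqP (a : nat -> R) : reflect (U [set n | a n = 0]) (a \in null_seq).
Proof. exact: asboolP. Qed.

Lemma null_seq_ideal : idealr_closed null_seq.
Proof.
split.
  by apply/null_seqP; apply: filterS (@filterT _ U _).
  apply/null_seqP => U1; apply: (@filter_not_empty _ U).
  by apply: filterS U1 => n /= /eqP; rewrite oner_eq0.
move=> a x y /null_seqP Ux /null_seqP Uy; apply/null_seqP.
apply: filterS2 Ux Uy => n /= x0 y0.
by rewrite !fctE /= x0 y0 mulr0 addr0.
Qed.

HB.instance Definition _ := isIdealr.Build (nat -> R) null_seq null_seq_ideal.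

Definition ultrapower : Type := {ideal_quot null_seq}.
HB.instance Definition _ := GRing.ComNzRing.on ultrapower.

Definition ultraclass : (nat -> R) -> ultrapower := \pi_ultrapower.
HB.instance Definition _ := GRing.RMorphism.on ultraclass.

Lemma ultraclass_eq0 a : (ultraclass a == 0) = (a \in null_seq).
Proof.
by rewrite -[in RHS](subr0 a) Quotient.idealrBE -(rmorph0 ultraclass).
Qed.

Definition ultrainv (x : ultrapower) : ultrapower :=
  ultraclass (fun n => (repr x n)^-1).

Lemma ultraclassK x : ultraclass (repr x) = x.
Proof. exact: reprK. Qed.

(** A sequence outside the ideal is nonzero on a member of [U], because [U] is
    an ultrafilter; there its pointwise inverse is an inverse. *)
Lemma ultrainv_mulVx x : x != 0 -> ultrainv x * x = 1.
Proof.
rewrite -{1 3}(ultraclassK x) /ultrainv ultraclass_eq0 => /null_seqP Ux.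
have {Ux} : U (~` [set n | repr x n = 0]).
  by have [] := in_ultra_setVsetC (fun n => repr x n = 0) UU.
move=> Ux; apply/eqP; rewrite -rmorphM -(rmorph1 ultraclass) -subr_eq0 -rmorphB.
rewrite ultraclass_eq0; apply/null_seqP; apply: filterS Ux => n /= /eqP xn0.
by rewrite !fctE /= mulVf ?subrr.
Qed.

Lemma ultrainv0 : ultrainv 0 = 0.
Proof.
apply/eqP; rewrite ultraclass_eq0; apply/null_seqP.
have : repr (0 : ultrapower) \in null_seq.
  by rewrite -ultraclass_eq0; apply/eqP; exact: ultraclassK.
by move=> /null_seqP; apply: filterS => n /= ->; rewrite invr0.
Qed.

HB.instance Definition _ :=
  GRing.ComNzRing_isField.Build ultrapower ultrainv_mulVx ultrainv0.

End Ultrapower.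
Arguments ultrapower R U {UU}.

(** Evaluation at an index as a ring morphism: an identity between sequences can
    be checked on each coordinate with the [rmorph] lemmas. *)
Section Coordinate.
Context {R : nzRingType} (n : nat).

Definition coordinate (a : nat -> R) : R := a n.

Let coordinate_zmod : zmod_morphism coordinate. Proof. by []. Qed.
Let coordinate_monoid : monoid_morphism coordinate. Proof. by []. Qed.
HB.instance Definition _ :=
  GRing.isZmodMorphism.Build (nat -> R) R coordinate coordinate_zmod.
HB.instance Definition _ :=
  GRing.isMonoidMorphism.Build (nat -> R) R coordinate coordinate_monoid.

End Coordinate.

Lemma horner_intr_rmorph {A B : comNzRingType} (f : {rmorphism A -> B})
    (p : {poly int}) (x : A) :
  (map_poly intr p).[f x] = f (map_poly intr p).[x].
Proof.
rewrite -horner_map -map_poly_comp; congr _.[_].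
by apply: eq_map_poly => c /=; rewrite rmorph_int.
Qed.

Lemma finite_roots {K : idomainType} {p : {poly K}} :
  p != 0 -> finite_set [set x | root p x].
Proof.
move=> p0; apply: contrapT => /(infinite_set_fset (size p))[rs rsp].
apply/negP; rewrite -ltnNge; apply: max_poly_roots => //; last first.
  exact: finmap.fset_uniq.
by apply/allP => x /rsp.
Qed.

Lemma finite_set_near_infty {A : set nat} :
  finite_set A -> \forall n \near \oo, ~ A n.
Proof.
move=> /finite_seqP[s ->]; exists (\max_(i <- s) i).+1 => // n /= ltn sn.
have := leq_ltn_trans (@leq_bigmax_seq _ s xpredT id n sn isT) ltn.
by rewrite ltnn.
Qed.

(** An injective sequence takes each root of a nonzero integer polynomial
    finitely often, so that modulo an ultrafilter finer than the cofinite one it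
    is a root of none: its class is transcendental over the integers. *)
Lemma exists_ultrapower {R : realType} (v : nat -> R) : injective v ->
  exists (L : fieldType) (f : {rmorphism (nat -> R) -> L}),
    (forall n, n%:R = 0 :> L -> n = 0%N) /\
    (forall p : {poly int}, root (map_poly intr p) (f v) -> p = 0).
Proof.
move=> vI.
have [L [f f_neq0]] : exists (L : fieldType) (f : {rmorphism (nat -> R) -> L}),
    forall a : nat -> R, (\forall n \near \oo, a n != 0) -> f a != 0.
  have [U [UU cofU]] := @ultraFilterLemma nat \oo _.
  exists (ultrapower R U), ultraclass => a /cofU Ua.
  rewrite ultraclass_eq0; apply/negP => /null_seqP Ua'.
  apply: (@filter_not_empty _ U).
  by apply: filterS2 Ua Ua' => n /= /eqP.
exists L, f; split=> [n | p].
  rewrite -(rmorph_nat f); case: n => // n /eqP.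
  apply: contraTP => _; apply: f_neq0; near=> k.
  by rewrite -[X in X != _]/(coordinate k _) rmorph_nat pnatr_eq0.
have [//|p0] := eqVneq p 0; rewrite /root (horner_intr_rmorph f p v).
rewrite (negbTE (f_neq0 _ _))//.
have {}p0 : map_poly intr p != 0 :> {poly R}.
  by rewrite map_poly_eq0_id0 ?intr_eq0 ?lead_coef_eq0.
have := finite_set_near_infty (finite_preimage (in2W vI) (finite_roots p0)).
apply: filterS => n /= /negP.
rewrite -[X in _ -> X != _]/(coordinate n _).
by rewrite -(horner_intr_rmorph (coordinate n) p v).
Unshelve. all: by end_near. Qed.

(** * Dual numbers *)

(** L[eps] with eps^2 = 0; the pair (a, b) stands for a + b eps.  It is a type
    of its own because L * L carries the componentwise product. *)
Definition dual_number (L : Type) : Type := (L * L)%type.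

Section DualNumbers.
Context {L : comNzRingType}.
Implicit Types x y : dual_number L.

HB.instance Definition _ := GRing.Zmodule.copy (dual_number L) (L * L)%type.

Definition dual_one : dual_number L := (1, 0).
Definition dual_mul x y : dual_number L := (x.1 * y.1, x.1 * y.2 + x.2 * y.1).

Let mulA : associative dual_mul.
Proof. by move=> x y z; congr (_, _) => /=; ring. Qed.
Let mulC : commutative dual_mul.
Proof. by move=> x y; congr (_, _) => /=; ring. Qed.
Let mul1 : left_id dual_one dual_mul.
Proof. by move=> [a b]; congr (_, _) => /=; ring. Qed.
Let mulDl : left_distributive dual_mul +%R.
Proof. by move=> x y z; congr (_, _) => /=; ring. Qed.
Let one_neq0 : dual_one != 0.
Proof. by apply/eqP => -[/eqP]; rewrite oner_eq0. Qed.

HB.instance Definition _ := GRing.Zmodule_isComNzRing.Build (dual_number L)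
  mulA mulC mul1 mulDl one_neq0.

Definition std_part x : L := x.1.
Definition eps_part x : L := x.2.
Arguments std_part x : simpl never.
Arguments eps_part x : simpl never.

Let std_part_zmod : zmod_morphism std_part. Proof. by []. Qed.
Let std_part_monoid : monoid_morphism std_part. Proof. by []. Qed.
HB.instance Definition _ :=
  GRing.isZmodMorphism.Build (dual_number L) L std_part std_part_zmod.
HB.instance Definition _ :=
  GRing.isMonoidMorphism.Build (dual_number L) L std_part std_part_monoid.
Let eps_part_zmod : zmod_morphism eps_part. Proof. by []. Qed.
HB.instance Definition _ :=
  GRing.isZmodMorphism.Build (dual_number L) L eps_part eps_part_zmod.

Lemma eps_partM x y :
  eps_part (x * y) = std_part x * eps_part y + eps_part x * std_part y.
Proof. by []. Qed.

Lemma dual_eq x y : std_part x = std_part y -> eps_part x = eps_part y -> x = y.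
Proof.
by case: x y => [a b] [c d]; rewrite /std_part /eps_part /= => -> ->.
Qed.

Lemma std_part_horner (p : {poly dual_number L}) a u :
  std_part p.[(a, u)] = std_part p.[(a, 0)].
Proof. by rewrite -!horner_map. Qed.

(** First-order Taylor expansion: the coefficient of eps is affine in the
    infinitesimal displacement [u] of the point, with slope the derivative. *)
Lemma eps_part_horner (p : {poly dual_number L}) a u :
  eps_part p.[(a, u)] = eps_part p.[(a, 0)] + std_part p^`().[(a, 0)] * u.
Proof.
elim/poly_ind: p => [|p c IHp].
  by rewrite deriv0 !horner0 !raddf0 mul0r addr0.
rewrite derivMXaddC !hornerMXaddC hornerD hornerMX !raddfD /=.
rewrite rmorphM /= !eps_partM IHp std_part_horner /std_part /eps_part /=; ring.
Qed.

(** [l] plays the role of D x / x; written without a quotient so that it also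
    makes sense in a ring. *)
Definition log_derivative x l := eps_part x = std_part x * l.

Lemma log_derivative1 : log_derivative 1 0.
Proof. by rewrite /log_derivative mulr0. Qed.

Lemma log_derivativeM x y l l' :
  log_derivative x l -> log_derivative y l' -> log_derivative (x * y) (l + l').
Proof.
by rewrite /log_derivative eps_partM rmorphM /= => -> ->; ring.
Qed.

Lemma log_derivativeX x l n :
  log_derivative x l -> log_derivative (x ^+ n) (n%:R * l).
Proof.
move=> xl; elim: n => [|n IHn].
  by rewrite expr0 mul0r; exact: log_derivative1.
rewrite exprS -natr1 mulrDl mul1r addrC; exact: log_derivativeM.
Qed.

Lemma log_derivative_prod (I : Type) (r : seq I) (P : pred I)
    (x : I -> dual_number L) (l : I -> L) :
    (forall i, P i -> log_derivative (x i) (l i)) ->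
  log_derivative (\prod_(i <- r | P i) x i) (\sum_(i <- r | P i) l i).
Proof.
move=> xl; apply: big_rec2 => [|i l' y Pi]; first exact: log_derivative1.
by apply: log_derivativeM; exact: xl.
Qed.

End DualNumbers.
Arguments std_part {L} x : simpl never.
Arguments eps_part {L} x : simpl never.

Lemma eps_part_sqr (L : comNzRingType) (x : dual_number L) :
  eps_part (x ^+ 2) = 2 * (std_part x * eps_part x).
Proof. by rewrite expr2 eps_partM; ring. Qed.

Lemma eps_part_nat (L : comNzRingType) n : eps_part (n%:R : dual_number L) = 0.
Proof. by rewrite raddfMn /eps_part /= mul0rn. Qed.

Lemma eps_part_natM (L : comNzRingType) n (x : dual_number L) :
  eps_part (n%:R * x) = n%:R * eps_part x.
Proof. by rewrite !mulr_natl raddfMn. Qed.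

(** * Infinitesimal deformations *)

(** A morphism a |-> s a + eps (D a) for which D a is determined by s a: on the
    image of s in L it defines a derivation with values in L. *)
Definition no_vertical (L A : comNzRingType) (psi : A -> dual_number L) :=
  forall a, std_part (psi a) = 0 -> psi a = 0.

(** The extension of [psi] to polynomials that sends the variable to
    x + u eps: the derivation extended to the element [x] by D x = u. *)
Definition adjoin (L A : comNzRingType) (psi : {rmorphism A -> dual_number L})
    (x u : L) : {rmorphism {poly A} -> dual_number L} :=
  horner_eval ((x, u) : dual_number L) \o map_poly psi.

(** Extension of derivations in characteristic 0.  If [x] is transcendental over
    the image of [psi], every [u] works.  Otherwise let [m] be an annihilating
    polynomial of least degree; its derivative does not vanish at [x], so there
    is a unique [u] for which the lift of [m] vanishes at x + u eps.
    Pseudo-division by [m] extends this to every polynomial that vanishes at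
    [x]. *)
Lemma adjoin_no_vertical (L : fieldType) (A : comNzRingType)
    (psi : {rmorphism A -> dual_number L}) (x : L) :
    (forall n, n%:R = 0 :> L -> n = 0%N) ->
  no_vertical psi -> exists u, no_vertical (adjoin psi x u).
Proof.
move=> char0 psiN.
pose annihilates (m : {poly A}) :=
  map_poly psi m <> 0 /\ std_part (map_poly psi m).[(x, 0)] = 0.
have [has_ann|none] := pselect (exists n,
    `[< exists m : {poly A}, annihilates m /\ size m = n >]); last first.
  exists 0 => p /= px0.
  have [/= p0|pN0] := pselect (map_poly psi p = 0).
    by rewrite /horner_eval p0 horner0.
  by case: none; exists (size p); apply/asboolP; exists p.
case: (ex_minnP has_ann) => _ /asboolP[m [[mN0 mx0] <-]] size_min.
have min (q : {poly A}) : (size q < size m)%N ->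
    std_part (map_poly psi q).[(x, 0)] = 0 -> map_poly psi q = 0.
  move=> qm qx; apply: contrapT => qN0; move: qm; rewrite ltnNge.
  by rewrite size_min//; apply/asboolP; exists q.
pose lc := lead_coef m.
have m0 : m != 0 by apply: contra_notN mN0 => /eqP ->; rewrite rmorph0.
(* were the leading coefficient killed by [psi], dropping it from [m] would give
   an annihilating polynomial of smaller degree *)
have lcN0 : std_part (psi lc) != 0.
  apply/eqP => /psiN lc0.
  have mE : map_poly psi m = map_poly psi (m - lc *: 'X^((size m).-1)).
    by rewrite rmorphB /= linearZ_LR /= lc0 scale0r subr0.
  apply: mN0; rewrite mE; apply: min; last by rewrite -mE.
  have mS : (size m).-1.+1 = size m by rewrite polySpred.
  rewrite -[X in (_ < X)%N]mS ltnS; apply/leq_sizeP => j; rewrite leq_eqVlt.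
  rewrite coefB coefZ coefXn => /predU1P[<-|jm].
    by rewrite eqxx mulr1 /lc lead_coefE subrr.
  by rewrite gtn_eqF// mulr0 subr0 nth_default// -mS.
have mdx : std_part (map_poly psi m)^`().[(x, 0)] != 0.
  rewrite deriv_map; apply/eqP => mdx0.
  have := min _ (lt_size_deriv m0) mdx0.
  move=> /(congr1 (fun p : {poly dual_number L} => std_part p`_(size m).-2)).
  rewrite coef0 raddf0 coef_map coef_deriv.
  have [m1|m1] := leqP (size m) 1.
    case: mN0; rewrite (size1_polyC m1) map_polyC in mx0 *.
    by rewrite hornerC in mx0; rewrite /= (psiN _ mx0).
  rewrite prednK ?ltn_predRL// raddfMn /= rmorphMn /=.
  move/eqP; rewrite -mulr_natr mulf_eq0 (negPf lcN0) /= => /eqP /char0 m2.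
  by move: m1; rewrite -ltn_predRL m2.
(* the root of the affine function of [eps_part_horner] *)
pose u := - eps_part (map_poly psi m).[(x, 0)] /
  std_part (map_poly psi m)^`().[(x, 0)].
have mu : (map_poly psi m).[(x, u)] = 0.
  apply: dual_eq; first by rewrite std_part_horner mx0.
  by rewrite eps_part_horner /u mulrC divfK// subrr raddf0.
exists u => p /= pu0.
rewrite /horner_eval in pu0 *.
case: (Pdiv.ComRing.redivpP p m) => k' q r E /(_ m0) rm.
have : psi (lc ^+ k') * (map_poly psi p).[(x, u)] = (map_poly psi r).[(x, u)].
  have := congr1 (fun p => (map_poly psi p).[(x, u)]) E.
  rewrite /= rmorphD rmorphM /= linearZ_LR /= hornerZ hornerD hornerM.
  by rewrite mu mulr0 add0r.
move=> eval_r.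
have r0 : map_poly psi r = 0.
  apply: min => //; rewrite -(std_part_horner _ _ u) -eval_r rmorphM /= pu0.
  by rewrite mulr0.
apply: dual_eq; first by rewrite pu0.
move: eval_r; rewrite r0 horner0 => /(congr1 eps_part).
rewrite eps_partM pu0 mulr0 addr0 raddf0 => /eqP.
by rewrite mulf_eq0 !rmorphXn /= expf_eq0 (negPf lcN0) andbF => /eqP.
Qed.

Lemma adjoin_seq (L : fieldType) (s : seq L) (A : comNzRingType)
    (psi : {rmorphism A -> dual_number L}) :
    (forall n, n%:R = 0 :> L -> n = 0%N) -> no_vertical psi ->
  exists (B : comNzRingType) (chi : {rmorphism B -> dual_number L})
      (j : A -> B),
    [/\ no_vertical chi, forall a, chi (j a) = psi a
      & forall x, x \in s -> exists b, std_part (chi b) = x].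
Proof.
move=> char0 psiN; elim: s => [|x s [B [chi [j [chiN chij chis]]]]].
  by exists A, psi, id.
have [u adjN] := adjoin_no_vertical x char0 chiN.
have adjC b : adjoin chi x u b%:P = chi b.
  by rewrite /= /horner_eval map_polyC hornerC.
exists {poly B}, (adjoin chi x u), (fun a => (j a)%:P); split=> [//|a|y].
  by rewrite adjC chij.
rewrite inE => /predU1P[-> | /chis[b <-]]; last by exists b%:P; rewrite adjC.
by exists 'X; rewrite /= /horner_eval map_polyX hornerX.
Qed.

(** A transcendental [v] may be moved with unit speed: every polynomial relation
    with integer coefficients between [v] and the [z i] persists to first order
    at v + eps for a suitable displacement of the [z i]. *)
Lemma tangent_lift (L : fieldType) (v : L) (I : finType) (z : I -> L) :
    (forall n, n%:R = 0 :> L -> n = 0%N) ->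
    (forall p : {poly int}, root (map_poly intr p) v -> p = 0) ->
  exists (A : comNzRingType) (psi : {rmorphism A -> dual_number L})
      (V : A) (Z : I -> A),
    [/\ no_vertical psi, psi V = (v, 1) & forall i, std_part (psi (Z i)) = z i].
Proof.
move=> char0 vtr.
(* over the integers the only relation satisfied by [v] is the trivial one, so
   that the speed 1 can be prescribed *)
pose psi0 : {rmorphism int -> dual_number L} := intr.
have psi1N : no_vertical (adjoin psi0 v 1).
  move=> p pv0; suff -> : p = 0 by rewrite raddf0.
  apply: vtr; rewrite /root -[X in _ == X]pv0 -horner_map -map_poly_comp /=.
  apply/eqP; congr _.[_]; apply: eq_map_poly => c /=.
  by rewrite rmorph_int.
have [A [psi [j [psiN psij psiz]]]] := adjoin_seq (codom z) char0 psi1N.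
have /choice[Z psiZ] i : exists a, std_part (psi a) = z i.
  by apply: psiz; exact: codom_f.
exists A, psi, (j 'X), Z; split=> //.
by rewrite psij /= /horner_eval map_polyX hornerX.
Qed.

(** * Critical values of the product of distances *)

Section PairSums.
Context {A : comNzRingType} {N : nat}.
Implicit Types (z e : 'M[A]_(2, N)) (p : 'I_N * 'I_N) (w : 'I_N * 'I_N -> A).

Definition sqdist z p : A := \sum_k (z k p.1 - z k p.2) ^+ 2.

(** For suitable weights, a constant multiple of the differential of the
    Hamiltonian at [z], as a linear form in the displacement [e]. *)
Definition pair_form w z e : A :=
  \sum_(p : 'I_N * 'I_N | (p.1 < p.2)%N)
    w p * \sum_k (z k p.1 - z k p.2) * (e k p.1 - e k p.2).

Lemma pair_form_linear w z : linear_for *%R (pair_form w z).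
Proof.
move=> a e e'; rewrite /pair_form mulr_sumr -big_split /=.
apply: eq_bigr => p _; rewrite mulrCA -mulrDr; congr (_ * _).
rewrite mulr_sumr -big_split /=.
by apply: eq_bigr => k _; rewrite !mxE; ring.
Qed.
HB.instance Definition _ w z :=
  GRing.isLinear.Build A 'M[A]_(2, N) A *%R (pair_form w z)
    (pair_form_linear w z).

Lemma pair_form_basis w z e :
  pair_form w z e = \sum_k \sum_i e k i * pair_form w z (delta_mx k i).
Proof.
rewrite [in LHS](matrix_sum_delta e) linear_sum; apply: eq_bigr => k _.
by rewrite linear_sum; apply: eq_bigr => i _; rewrite linearZ.
Qed.

End PairSums.

Lemma rmorph_sqdist (A B : comNzRingType) (N : nat) (f : {rmorphism A -> B})
    (z : 'M[A]_(2, N)) p : f (sqdist z p) = sqdist (map_mx f z) p.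
Proof.
by rewrite rmorph_sum; apply: eq_bigr => k _; rewrite rmorphXn rmorphB !mxE.
Qed.

Lemma rmorph_pair_form (A B : comNzRingType) (N : nat) (f : {rmorphism A -> B})
    w (z e : 'M[A]_(2, N)) :
  f (pair_form w z e) = pair_form (f \o w) (map_mx f z) (map_mx f e).
Proof.
rewrite rmorph_sum; apply: eq_bigr => p _; rewrite rmorphM rmorph_sum /=.
congr (_ * _); apply: eq_bigr => k _.
by rewrite rmorphM !rmorphB !mxE.
Qed.

(** The core of the proof.  If the critical value [v] were transcendental, a
    deformation with D v = 1 would exist; but the critical point equations make
    the logarithmic derivative of the product proportional to the derivative of
    the moment of inertia, which vanishes since that moment is an integer. *)
Lemma critical_value_algebraic (L : fieldType) (N : nat) (g : 'I_N -> nat)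
    (z : 'M[L]_(2, N)) (w : 'I_N * 'I_N -> L) (kappa : L) (c : nat) :
    (forall n, n%:R = 0 :> L -> n = 0%N) ->
    (forall p : 'I_N * 'I_N, (p.1 < p.2)%N -> w p * sqdist z p = 1) ->
    (forall k i, pair_form (fun p => (g p.1 * g p.2)%:R * w p) z (delta_mx k i)
       = kappa * ((g i)%:R * z k i)) ->
    \sum_i (g i)%:R * \sum_k z k i ^+ 2 = c%:R ->
  ~ (forall q : {poly int},
       root (map_poly intr q)
         (\prod_(p : 'I_N * 'I_N | (p.1 < p.2)%N)
            sqdist z p ^+ (g p.1 * g p.2)) -> q = 0).
Proof.
set v := \prod_(p | _) _ => char0 wz crit moment vtr.
have [A [psi [V [Z [psiN psiV psiZ]]]]] :=
  tangent_lift (fun ki : 'I_2 * 'I_N => z ki.1 ki.2) char0 vtr.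
pose ZM : 'M[A]_(2, N) := \matrix_(k, i) Z (k, i).
pose e : 'M[L]_(2, N) := \matrix_(k, i) eps_part (psi (Z (k, i))).
have stdZ k i : std_part (psi (ZM k i)) = z k i by rewrite mxE psiZ.
have epsZ k i : eps_part (psi (ZM k i)) = e k i by rewrite !mxE.
(* the absence of vertical vectors: an identity between values lifts *)
have std_eq a b : std_part (psi a) = std_part (psi b) -> psi a = psi b.
  move=> ab; apply/eqP; rewrite -subr_eq0 -rmorphB; apply/eqP/psiN.
  by rewrite !rmorphB /= ab subrr.
have std_sqdist p : std_part (psi (sqdist ZM p)) = sqdist z p.
  rewrite !rmorph_sum; apply: eq_bigr => k _.
  by rewrite !(rmorphXn, rmorphB) /= !stdZ.
have tangent_inertia : 2 * (\sum_k \sum_i e k i * ((g i)%:R * z k i)) = 0.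
  pose J := \sum_i (g i)%:R * \sum_k ZM k i ^+ 2.
  have /(congr1 eps_part) : psi J = psi c%:R.
    apply: std_eq; rewrite !rmorph_nat -moment !rmorph_sum.
    apply: eq_bigr => i _.
    rewrite !rmorphM !rmorph_nat !rmorph_sum; congr (_ * _).
    by apply: eq_bigr => k _; rewrite !rmorphXn /= stdZ.
  rewrite rmorph_nat eps_part_nat => J0; rewrite -[RHS]J0.
  rewrite exchange_big rmorph_sum (raddf_sum eps_part) mulr_sumr.
  apply: eq_bigr => i _.
  rewrite rmorphM rmorph_nat /= eps_part_natM rmorph_sum (raddf_sum eps_part).
  rewrite !mulr_sumr; apply: eq_bigr => k _.
  by rewrite /= rmorphXn eps_part_sqr /= stdZ epsZ; ring.
have eps_sqdist p : eps_part (psi (sqdist ZM p)) =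
    2 * \sum_k (z k p.1 - z k p.2) * (e k p.1 - e k p.2).
  rewrite rmorph_sum (raddf_sum eps_part) mulr_sumr; apply: eq_bigr => k _.
  by rewrite /= rmorphXn eps_part_sqr !rmorphB !raddfB /= !stdZ !epsZ.
have : log_derivative (psi V)
    (\sum_(p : 'I_N * 'I_N | (p.1 < p.2)%N)
      (g p.1 * g p.2)%:R * (w p * eps_part (psi (sqdist ZM p)))).
  have -> : psi V = psi (\prod_(p : 'I_N * 'I_N | (p.1 < p.2)%N)
      sqdist ZM p ^+ (g p.1 * g p.2)).
    apply: std_eq; rewrite psiV !rmorph_prod; apply: eq_bigr => p _.
    by rewrite !rmorphXn /= std_sqdist.
  rewrite rmorph_prod; apply: log_derivative_prod => p ltp.
  rewrite rmorphXn; apply: log_derivativeX.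
  by rewrite /log_derivative std_sqdist mulrA [_ * w p]mulrC wz// mul1r.
rewrite /log_derivative psiV /eps_part /=.
have -> : \sum_(p : 'I_N * 'I_N | (p.1 < p.2)%N)
    (g p.1 * g p.2)%:R * (w p * eps_part (psi (sqdist ZM p))) =
    2 * pair_form (fun p => (g p.1 * g p.2)%:R * w p) z e.
  rewrite mulr_sumr; apply: eq_bigr => p _.
  by rewrite eps_sqdist; ring.
rewrite pair_form_basis.
have -> : \sum_k \sum_i e k i *
      pair_form (fun p => (g p.1 * g p.2)%:R * w p) z (delta_mx k i) =
    kappa * \sum_k \sum_i e k i * ((g i)%:R * z k i).
  rewrite mulr_sumr; apply: eq_bigr => k _; rewrite mulr_sumr.
  by apply: eq_bigr => i _; rewrite crit mulrCA.
rewrite [2 * (kappa * _)]mulrCA tangent_inertia !mulr0 => /eqP.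
by rewrite oner_eq0.
Qed.

(** * Relative equilibria as critical points *)

Section Analysis.
Context {R : realType}.

Lemma Jmx_sqr : Jmx ^+ 2 = - 1 :> 'M[R]_2.
Proof.
apply/matrixP => i j; rewrite expr2 -mulmxE !mxE !big_ord_recl big_ord0 !mxE.
by case: i => [[|[|//]] ?]; case: j => [[|[|//]] ?]; rewrite !eqE /=; ring.
Qed.

Lemma JmxX n : Jmx ^+ n =
  ((~~ odd n)%:R * (-1) ^+ n./2) *: 1 + ((odd n)%:R * (-1) ^+ n.-1./2) *: Jmx
  :> 'M[R]_2.
Proof.
rewrite -{1}(odd_double_half n) exprD -mul2n exprM Jmx_sqr commr_sign.
case: (boolP (odd n)) => on /=; rewrite mul0r scale0r mul1r ?add0r ?addr0.
  rewrite -{2}(odd_double_half n) on /= doubleK.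
  by rewrite -!(signr_odd _ n./2) scaler_sign mulr_sign.
by rewrite -!(signr_odd _ n./2) scaler_sign mulr_sign.
Qed.

Lemma expmx_rotation (theta : R) :
  expmx (theta *: Jmx) = cos theta *: 1 + sin theta *: Jmx.
Proof.
rewrite /expmx; apply: cvg_lim; first exact: norm_hausdorff.
have -> : series (fun k => k`!%:R^-1 *: (theta *: Jmx) ^+ k) =
    (fun n => series (cos_coeff theta) n *: (1 : 'M[R]_2)
            + series (sin_coeff theta) n *: Jmx).
  apply/funext => n; rewrite /series /= !scaler_suml -big_split /=.
  apply: eq_bigr => k _; rewrite exprZn JmxX !scalerDr !scalerA.
  by congr (_ *: _ + _ *: _); rewrite /cos_coeff /sin_coeff /= -?exprnP; ring.
apply: cvgD; apply: cvgZr_tmp.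
  rewrite unlock; exact: is_cvg_series_cos_coeff.
rewrite unlock; exact: is_cvg_series_sin_coeff.
Qed.

Lemma is_derive_rotation (omega a b : R) :
  is_derive (0 : R) 1 (fun t => cos (omega * t) * a + sin (omega * t) * b)
    (omega * b).
Proof.
have mulE : is_derive (0 : R) 1 (fun t : R => omega * t) omega.
  have -> : (fun t : R => omega * t) = omega \*: id by [].
  by rewrite -[X in is_derive _ _ _ X]mulr1; exact: is_deriveZ.
have Dc := is_derive1_comp (is_derive_cos _) mulE.
have Ds := is_derive1_comp (is_derive_sin _) mulE.
rewrite !mulr0 sin0 cos0 in Dc Ds.
have -> : (fun t : R => cos (omega * t) * a + sin (omega * t) * b) =
    a \*: (cos \o *%R omega) + b \*: (sin \o *%R omega).
  by apply/funext => t; rewrite !fctE /= ![_ *: _]mulrC.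
apply: is_derive_eq.
by rewrite oppr0 mul0r scaler0 add0r mul1r [_ *: _]mulrC.
Qed.

Lemma is_derive_big (I : Type) (r : seq I) (P : pred I) (f : I -> R -> R)
    (df : I -> R) (x : R) :
    (forall i, P i -> is_derive x 1 (f i) (df i)) ->
  is_derive x 1 (fun y => \sum_(i <- r | P i) f i y) (\sum_(i <- r | P i) df i).
Proof.
move=> fdf; rewrite -(fct_sumE r P f).
elim/big_rec2: _ => [|i g h Pi hg]; first exact: is_derive_cst.
have fi := fdf i Pi; exact: is_deriveD.
Qed.

Context {N : nat}.
Implicit Types (Gamma : 'rV[R]_N) (z e : 'M[R]_(2, N)) (p : 'I_N * 'I_N).

Lemma hamiltonian_pairs Gamma z :
  hamiltonian Gamma z = - (4 * pi)^-1 *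
    \sum_(p : 'I_N * 'I_N | (p.1 < p.2)%N)
      Gamma 0 p.1 * Gamma 0 p.2 * ln (sqdist z p).
Proof.
rewrite /hamiltonian pair_big_dep /=; congr (_ * _); apply: eq_bigr => p _.
congr (_ * ln _); apply: eq_bigr => k _.
by rewrite !mxE.
Qed.

Lemma sqdist_gt0 z p : ~ collision z -> (p.1 < p.2)%N -> 0 < sqdist z p.
Proof.
move=> zN ltp; rewrite lt_neqAle; apply/andP; split; last first.
  by apply: sumr_ge0 => k _; rewrite sqr_ge0.
apply/negP; rewrite eq_sym psumr_eq0 => [/allP z0|k _]; last by rewrite sqr_ge0.
apply: zN; exists p.1, p.2; split=> //; apply/colP => k; rewrite !mxE.
by have := z0 k (mem_index_enum k); rewrite sqrf_eq0 subr_eq0 => /eqP.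
Qed.

Lemma sqdist_line z e p (t : R) :
  sqdist (t *: e + z) p =
  \sum_k (t * (e k p.1 - e k p.2) + (z k p.1 - z k p.2)) ^+ 2.
Proof. by apply: eq_bigr => k _; rewrite !mxE; congr (_ ^+ 2); ring. Qed.

Lemma is_derive_sqdist z e p :
  is_derive (0 : R) 1 (fun t => sqdist (t *: e + z) p)
    (2 * \sum_k (z k p.1 - z k p.2) * (e k p.1 - e k p.2)).
Proof.
under [X in is_derive _ _ X _]funext do rewrite sqdist_line.
rewrite mulr_sumr; apply: is_derive_big => k _.
set a := e k p.1 - _; set b := z k p.1 - _.
have -> : (fun t : R => (t * a + b) ^+ 2) = (a \*: id + cst b) ^+ 2.
  by apply/funext => t; rewrite !fctE /= [_ *: _]mulrC.
apply: is_derive_eq.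
rewrite !fctE /= expr1 scaler0 add0r addr0.
by rewrite [_ *: 1]mulr1 [_ *: a]mulrAC mulrA mulrAC.
Qed.

Lemma derive_hamiltonian Gamma z e : ~ collision z ->
  'D_e (hamiltonian Gamma) z = - (2 * pi)^-1 *
    pair_form (fun p => Gamma 0 p.1 * Gamma 0 p.2 * (sqdist z p)^-1) z e.
Proof.
move=> zN.
(* a directional derivative is the derivative of a function of one variable *)
pose line (t : R) := hamiltonian Gamma (t *: e + z).
have -> : 'D_e (hamiltonian Gamma) z = 'D_1 line 0.
  rewrite /derive.
  set F := (fun h => _ *: (_ - hamiltonian _ _)).
  set G := (fun h => _ *: (_ - line 0)).
  suff -> : F = G by [].
  apply/funext => h; rewrite /F /G /line /=.
  by rewrite [h *: 1]mulr1 addr0 scale0r add0r.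
have -> : line = (- (4 * pi)^-1) \*: (fun t : R =>
    \sum_(p : 'I_N * 'I_N | (p.1 < p.2)%N)
      Gamma 0 p.1 * Gamma 0 p.2 * ln (sqdist (t *: e + z) p)).
  by apply/funext => t; rewrite /line hamiltonian_pairs.
apply: derive_val.
have -> : - (2 * pi)^-1 * pair_form
      (fun p => Gamma 0 p.1 * Gamma 0 p.2 * (sqdist z p)^-1) z e =
    - (4 * pi)^-1 *: \sum_(p : 'I_N * 'I_N | (p.1 < p.2)%N)
      Gamma 0 p.1 * Gamma 0 p.2 *: ((sqdist z p)^-1 *
        (2 * \sum_k (z k p.1 - z k p.2) * (e k p.1 - e k p.2))).
  have -> : (2 * pi)^-1 = 2 * (4 * pi)^-1 :> R.
    have : (pi : R) != 0 by rewrite gt_eqF ?pi_gt0.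
    by move: (pi : R) => x x0; field.
  rewrite /pair_form mulr_sumr scaler_sumr; apply: eq_bigr => p _.
  by rewrite /GRing.scale /=; ring.
apply: is_deriveZ; apply: is_derive_big => p ltp; apply: is_deriveZ.
have Ds := is_derive_sqdist z e p.
have Dl : is_derive (sqdist (0 *: e + z) p) 1 (@ln R) (sqdist z p)^-1.
  by rewrite scale0r add0r; apply: is_derive1_ln; exact: sqdist_gt0.
exact: (is_derive1_comp Dl Ds).
Qed.

(** The normalisation puts the centre of rotation at the origin, so the velocity
    at time 0 is omega J z; the equations of motion, in which J cancels, then
    say that the gradient of H is omega Gamma z. *)
Lemma relative_equilibrium_critical Gamma (z : R -> 'M[R]_(2, N)) :
    relative_equilibrium Gamma z -> normalised Gamma z ->
  exists kappa, forall k i,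
    pair_form (fun p => Gamma 0 p.1 * Gamma 0 p.2 * (sqdist (z 0) p)^-1)
      (z 0) (delta_mx k i) = kappa * (Gamma 0 i * z 0 k i).
Proof.
move=> [sol [omega rot]] norm; exists (- (2 * pi) * omega) => k i.
have [zN zD motion] := sol 0.
have c0 : vortex_center Gamma (z 0) = 0.
  by rewrite /vortex_center (norm 0).1 scaler0.
have zE t l j : z t l j =
    cos (omega * t) * z 0 l j + sin (omega * t) * (Jmx *m z 0) l j.
  have /colP /(_ l) := rot t j; rewrite /= c0 subr0 addr0 expmx_rotation.
  rewrite mulmxDl -!scalemxAl mul1mx !mxE => ->; congr (_ + _ * _).
  by apply: eq_bigr => s _; rewrite !mxE.
have velocity : 'D_1 z 0 = omega *: (Jmx *m z 0).
  rewrite derive_mx//; apply/matrixP => l j; rewrite [LHS]mxE [RHS]mxE.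
  have -> : (fun t : R => z t l j) = (fun t : R =>
      cos (omega * t) * z 0 l j + sin (omega * t) * (Jmx *m z 0) l j).
    by apply/funext => t.
  have D := is_derive_rotation omega (z 0 l j) ((Jmx *m z 0) l j).
  by rewrite derive_val.
have gradE :
    gradient (hamiltonian Gamma) (z 0) = omega *: (z 0 *m diag_mx Gamma).
  have := congr1 (mulmx (- Jmx)) motion.
  rewrite velocity -scalemxAl -scalemxAr !mulmxA.
  have -> : - Jmx *m Jmx = 1%:M :> 'M[R]_2.
    by rewrite mulNmx [Jmx *m Jmx]Jmx_sqr opprK.
  by rewrite !mul1mx.
rewrite mul_mx_diag in gradE.
have := congr1 (fun M : 'M[R]_(2, N) => M k i) gradE.
rewrite !mxE derive_hamiltonian//.
have : (pi : R) != 0 by rewrite gt_eqF ?pi_gt0.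
move: (pi : R) => x x0 E.
rewrite -mulrA [Gamma 0 i * _]mulrC -E.
by move: (pair_form _ _ _) => y; field.
Qed.

End Analysis.

(** * Finiteness of the set of energies *)

Lemma common_denominator (N : nat) (Gamma : 'rV[rat]_N) :
    (forall i, 0 < Gamma 0 i) ->
  exists d (g : 'I_N -> nat), (0 < d)%N /\
    forall i, d%:R * Gamma 0 i = (g i)%:R.
Proof.
move=> Gamma_gt0.
pose den (i : 'I_N) := `|denq (Gamma 0%R i)|%N.
exists (\prod_i den i)%N,
  (fun i => `|numq (Gamma 0%R i)| * \prod_(j | j != i) den j)%N.
split=> [|i].
  by apply: prodn_gt0 => i; rewrite absz_gt0 denq_neq0.
rewrite (bigD1 i)//= !natrM mulrAC; congr (_ * _).
rewrite /den !pmulrn !gtz0_abs ?denq_gt0 ?numq_gt0//.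
by rewrite numqE mulrC.
Qed.

Lemma eq_pair_form (A : comNzRingType) (N : nat)
    (w w' : 'I_N * 'I_N -> A) (z e : 'M[A]_(2, N)) :
    (forall p : 'I_N * 'I_N, (p.1 < p.2)%N -> w p = w' p) ->
  pair_form w z e = pair_form w' z e.
Proof. by move=> ww; apply: eq_bigr => p /ww ->. Qed.

Lemma pair_form_scale (A : comNzRingType) (N : nat) (a : A)
    (w : 'I_N * 'I_N -> A) (z e : 'M[A]_(2, N)) :
  pair_form (fun p => a * w p) z e = a * pair_form w z e.
Proof. by rewrite mulr_sumr; apply: eq_bigr => p _; rewrite mulrA. Qed.

(** The passage from the energy to an algebraic function of the positions. *)
Lemma expR_hamiltonian (R : realType) (N : nat) (Gamma : 'rV[R]_N) (d : nat)
    (g : 'I_N -> nat) (z : 'M[R]_(2, N)) :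
    (forall i, d%:R * Gamma 0 i = (g i)%:R) -> ~ collision z ->
  expR (- (4 * pi * d%:R ^+ 2) * hamiltonian Gamma z) =
  \prod_(p : 'I_N * 'I_N | (p.1 < p.2)%N) sqdist z p ^+ (g p.1 * g p.2).
Proof.
move=> dg zN; rewrite hamiltonian_pairs.
have -> S : - (4 * pi * d%:R ^+ 2) * (- (4 * pi)^-1 * S) = d%:R ^+ 2 * S :> R.
  have : (pi : R) != 0 by rewrite gt_eqF ?pi_gt0.
  by move: (pi : R) => x x0; field.
rewrite mulr_sumr expR_sum; apply: eq_bigr => p ltp.
have -> : d%:R ^+ 2 * (Gamma 0 p.1 * Gamma 0 p.2 * ln (sqdist z p)) =
    (g p.1 * g p.2)%:R * ln (sqdist z p).
  by rewrite natrM -!dg; ring.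
by rewrite expRM_natl lnK// posrE sqdist_gt0.
Qed.

(** The ultrapower inherits the critical point equations: [f] sends a sequence
    of real critical points to a critical point over [L], with the sequences of
    multipliers and of inverse squared distances as its auxiliary data. *)
Lemma critical_sequence_algebraic (R : realType) (N : nat) (L : fieldType)
    (f : {rmorphism (nat -> R) -> L}) (g : 'I_N -> nat) (c : nat)
    (z : nat -> 'M[R]_(2, N)) (kappa : nat -> R) :
    (forall n, n%:R = 0 :> L -> n = 0%N) ->
    (forall n, ~ collision (z n)) ->
    (forall n k i, pair_form (fun p => (g p.1 * g p.2)%:R * (sqdist (z n) p)^-1)
       (z n) (delta_mx k i) = kappa n * ((g i)%:R * z n k i)) ->
    (forall n, \sum_i (g i)%:R * \sum_k z n k i ^+ 2 = c%:R) ->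
  ~ (forall q : {poly int},
       root (map_poly intr q)
         (f (fun n => \prod_(p : 'I_N * 'I_N | (p.1 < p.2)%N)
            sqdist (z n) p ^+ (g p.1 * g p.2))) -> q = 0).
Proof.
move=> char0 zN crit moment.
pose zs : 'M[nat -> R]_(2, N) := \matrix_(k, i) (fun n => z n k i).
pose ws (p : 'I_N * 'I_N) : nat -> R := fun n => (sqdist (z n) p)^-1.
have seqP (a b : nat -> R) :
    (forall n, coordinate n a = coordinate n b) -> a = b.
  by move=> ab; apply/funext.
have zsE n : map_mx (coordinate n) zs = z n.
  by apply/matrixP => k i; rewrite !mxE.
have sqdist_seq n p : coordinate n (sqdist zs p) = sqdist (z n) p.
  by rewrite rmorph_sqdist zsE.
have -> : (fun n => \prod_(p : 'I_N * 'I_N | (p.1 < p.2)%N)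
    sqdist (z n) p ^+ (g p.1 * g p.2)) =
    \prod_(p : 'I_N * 'I_N | (p.1 < p.2)%N) sqdist zs p ^+ (g p.1 * g p.2).
  apply: seqP => n; rewrite rmorph_prod; apply: eq_bigr => p _.
  by rewrite rmorphXn /= sqdist_seq.
rewrite rmorph_prod.
under eq_bigr do rewrite rmorphXn /= rmorph_sqdist.
apply: (critical_value_algebraic (w := f \o ws) (kappa := f kappa) (c := c))
  => //.
- move=> p ltp; rewrite -rmorph_sqdist -rmorphM -(rmorph1 f); congr (f _).
  apply: seqP => n; rewrite rmorphM rmorph1 /= sqdist_seq.
  by rewrite [coordinate n _]/coordinate /ws mulVf// gt_eqF ?sqdist_gt0.
- move=> k i; rewrite mxE -(rmorph_nat f) -!rmorphM -(map_delta_mx f).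
  rewrite (@eq_pair_form _ _ _
    (f \o (fun p => (g p.1 * g p.2)%:R * ws p))); last first.
    by move=> p _; rewrite /= (rmorphM f) rmorph_nat.
  rewrite -rmorph_pair_form; congr (f _); apply: seqP => n.
  rewrite rmorph_pair_form zsE map_delta_mx.
  rewrite !(rmorphM (coordinate n)) rmorph_nat /= mxE.
  rewrite -[RHS]crit; apply: eq_pair_form => p _ /=.
  by rewrite (rmorphM (coordinate n)) rmorph_nat.
- rewrite -(rmorph_nat f) -(_ : \sum_i (g i)%:R * \sum_k zs k i ^+ 2 = c%:R).
    rewrite rmorph_sum; apply: eq_bigr => i _.
    rewrite rmorphM rmorph_nat rmorph_sum; congr (_ * _).
    by apply: eq_bigr => k _; rewrite rmorphXn !mxE.
  apply: seqP => n; rewrite rmorph_nat -(moment n) rmorph_sum.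
  apply: eq_bigr => i _; rewrite rmorphM rmorph_nat rmorph_sum /=.
  congr (_ * _).
  by apply: eq_bigr => k _; rewrite rmorphXn /= -(zsE n) [in RHS]mxE.
Qed.

Theorem theorem2p2 (R : realType) (N : nat) (hN : (2 <= N)%N)
  (Gamma : 'rV[rat]_N) (hGamma : forall i : 'I_N, 0 < Gamma 0 i) :
  finite_set (relative_equilibrium_energies (map_mx (ratr : rat -> R) Gamma)).
Proof.
have [d [g [d_gt0 dg]]] := common_denominator hGamma.
set GammaR := map_mx _ Gamma.
have {}dg i : d%:R * GammaR 0 i = (g i)%:R.
  by have := congr1 (ratr : rat -> R) (dg i); rewrite rmorphM !rmorph_nat mxE.
apply: contrapT => /infiniteP /pcard_leP /unsquash h.
have /choice[z zP] n : exists z : 'M[R]_(2, N), exists kappa : R,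
    [/\ ~ collision z, h n = hamiltonian GammaR z,
      \sum_i (g i)%:R * \sum_k z k i ^+ 2 = d%:R
    & forall k i, pair_form (fun p => (g p.1 * g p.2)%:R * (sqdist z p)^-1)
        z (delta_mx k i) = kappa * ((g i)%:R * z k i)].
  have [z [zeq znorm hE]] : relative_equilibrium_energies GammaR (h n).
    exact: funS.
  have [kappa crit] := relative_equilibrium_critical zeq znorm.
  exists (z 0), (d%:R * kappa); split=> [|//| |k i].
  - by have [] := zeq.1 0.
  - have := (znorm 0).2; rewrite /inertia => /(congr1 ( *%R d%:R)).
    rewrite mulr1 => <-; rewrite mulr_sumr; apply: eq_bigr => i _.
    rewrite mulrA dg; congr (_ * _); apply: eq_bigr => k _.
    by rewrite mxE.
  - rewrite (@eq_pair_form _ _ _ (fun p => d%:R ^+ 2 *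
      (GammaR 0 p.1 * GammaR 0 p.2 * (sqdist (z 0) p)^-1))); last first.
      by move=> p _; rewrite natrM -!dg; ring.
    by rewrite pair_form_scale crit -dg; ring.
have {zP} /choice[kappa zP] := zP.
pose v n := expR (- (4 * pi * d%:R ^+ 2) * h n) : R.
have v_inj : injective v.
  move=> m n /expR_inj /mulfI hmn.
  apply: (@inj _ _ _ h); rewrite ?inE//; apply: hmn.
  by rewrite oppr_eq0 gt_eqF// !mulr_gt0 ?exprn_gt0 ?pi_gt0 ?ltr0n.
have [L [f [char0 vtr]]] := exists_ultrapower v_inj.
apply: (@critical_sequence_algebraic R N L f g d z kappa char0).
- by move=> n; have [] := zP n.
- by move=> n; have [] := zP n.
- by move=> n; have [] := zP n.
suff <- : v = (fun n => \prod_(p : 'I_N * 'I_N | (p.1 < p.2)%N)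
  sqdist (z n) p ^+ (g p.1 * g p.2)) by [].
apply/funext => n; have [zN hE _ _] := zP n.
by rewrite /v hE; exact: expR_hamiltonian.
Qed.
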